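(* For all integers $n\geq 2$ and $d\geq 1$ there exists a Lebesgue-measurable set $E=E(d,n)\subseteq\mathbb{R}^d$ of density at least $$1-\frac{10\log n}{n^{1/5}}$$ such that there are arbitrarily large values of $r>0$ for which $E$ contains no congruent copy of $\{0,r,2r,\ldots,(n-1)r\}$.
   Context: $\log$ is the natural logarithm. The density of a measurable set $E\subseteq\mathbb{R}^d$ is the limit $\lim_{r\to+\infty}\mathcal{L}^d(E\cap B_r(0))/\mathcal{L}^d(B_r(0))$ (the assertion includes that this limit exists), where $\mathcal{L}^d$ is Lebesgue measure and $B_r(0)$ is the closed ball of radius $r$ centred at the origin. A congruent copy of $\{0,r,2r,\ldots,(n-1)r\}$ in $E$ means points $x_0,\dots,x_{n-1}\in E$ with $\|x_j-x_k\|=|j-k|\,r$ for all $0\leq j,k\leq n-1$, where $\|\cdot\|$ is the Euclidean norm. *)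

(* Defs.v *)
From HB Require Import structures.
From mathcomp Require Import all_boot all_order all_algebra.
From mathcomp Require Import all_classical all_reals all_analysis.

Set Implicit Arguments.
Unset Strict Implicit.
Unset Printing Implicit Defensive.
Import Order.TTheory GRing.Theory Num.Theory.
Import numFieldNormedType.Exports.

Local Open Scope classical_set_scope.
Local Open Scope ring_scope.

(** R^d is ['rV[R]_d]. Its library norm is the sup norm, so the Euclidean norm
    and its closed balls are introduced separately. *)
Definition enorm (R : realType) (d : nat) (x : 'rV[R]_d) : R :=
  Num.sqrt (\sum_(i < d) x ord0 i ^+ 2).

Definition eball (R : realType) (d : nat) (r : R) : set 'rV[R]_d :=
  [set x | enorm x <= r].

(** The half-open box prod_i ]a_i, b_i]; it is empty, and its volume is 0, as
    soon as b_i <= a_i for some i. *)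
Definition box (R : realType) (d : nat) (a b : 'rV[R]_d) : set 'rV[R]_d :=
  [set x | forall i : 'I_d, a ord0 i < x ord0 i <= b ord0 i].

Definition box_volume (R : realType) (d : nat) (a b : 'rV[R]_d) : R :=
  \prod_(i < d) Num.max 0 (b ord0 i - a ord0 i).

(** The Lebesgue measure on R^d: the outer measure generated by boxes, used on
    the sets that are measurable for it in the sense of Caratheodory. *)
Definition lebesgue_outer (R : realType) (d : nat) (A : set 'rV[R]_d) : \bar R :=
  ereal_inf [set s : \bar R | exists a b : nat -> 'rV[R]_d,
    A `<=` \bigcup_k box (a k) (b k) /\
    s = (\sum_(0 <= k <oo) (box_volume (a k) (b k))%:E)%E].

Definition lebesgue_measurable (R : realType) (d : nat) (E : set 'rV[R]_d) :
  Prop := (@lebesgue_outer R d).-caratheodory E.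

(** For d >= 1, balls have finite measure, positive when r > 0, so taking [fine]
    and dividing in [R] loses nothing in the limit r --> +oo. *)
Definition has_density (R : realType) (d : nat) (E : set 'rV[R]_d) (delta : R) :
  Prop :=
  (fun r : R => fine (lebesgue_outer (E `&` @eball R d r)) /
                fine (lebesgue_outer (@eball R d r))) @ +oo --> delta.

Definition contains_progression (R : realType) (d n : nat) (r : R)
    (E : set 'rV[R]_d) : Prop :=
  exists x : 'I_n -> 'rV[R]_d,
    (forall j, E (x j)) /\
    (forall j k : 'I_n, enorm (x j - x k) = `|j%:R - k%:R| * r).

(* Main.v *)
From HB Require Import structures.
Require Import Defs.
From mathcomp Require Import all_boot all_order all_algebra.
From mathcomp Require Import all_classical all_reals all_analysis.
From mathcomp Require Import measurable_realfun ring lra zify.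
Set Implicit Arguments.
Unset Strict Implicit.
Unset Printing Implicit Defensive.
Import Order.TTheory GRing.Theory Num.Theory.
Import numFieldNormedType.Exports.

Local Open Scope classical_set_scope.
Local Open Scope ring_scope.

(** The set is a union of thin-gapped spherical shells,
    E = { x | m < |x|^2 <= m + th for some natural m }, so that membership of x
    says that |x|^2 modulo 1 lies in ]0, th].

    Points x_0, ..., x_(n-1) at mutual distances |j - k| r are collinear and
    equally spaced, whence |x_j|^2 = A + B j + r^2 j^2
    ([progression_quadratic]). Take r^2 = M + 1/q^2 with M a natural number, as
    large as desired, and q about sqrt n. Modulo 1 the sequence is a quadratic
    one with leading coefficient 1/q^2, so its successive increments grow by
    2/q^2 at each step: within about the first half of the range some increment
    exceeds an integer by at most 2/q^2, and modulo 1 the sequence then moves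
    forward slowly. During the next q + 1 steps it advances by more than 1 in
    total, by increments of at most 2 (q + 1)/q^2, so it cannot jump over an arc
    of that length ([quadratic_meets_gap]). Hence th = 1 - 2 (q + 1)/q^2 makes E
    free of such progressions, and 1 - th is of order n^(-1/2), which is smaller
    than 10 log n / n^(1/5) ([density_bound]). For n < 25 the required density
    is at most 0 and the empty set does the job.

    It remains to see that E has density th. Balls of radius sqrt s have volume
    V g(s) with g(s) = (sqrt s)^d, so the m-th shell fills
    g(m + th) - g(m) out of g(m + 1) - g(m). As g is convex for d >= 2 and
    concave for d = 1, comparing chords of g shows that the first N shells have
    total volume th V g(N) up to shifting N by one and a bounded error
    ([sum_chords], [shells_volume_bounds]), and g(N + 1)/g(N) tends to 1.

    The volume of balls rests on the following facts on the outer measure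
    generated by boxes: it is countably subadditive, half-spaces are
    measurable for it because a coordinate hyperplane cuts a box into two boxes
    of the same total volume, it is homogeneous of degree d under dilations,
    and it gives boxes at least their volume
    ([box_volume_le_lebesgue_outer]), which makes balls non-negligible. *)

(** * The outer measure generated by boxes *)

Lemma sqr_enorm (R : realType) (d : nat) (x : 'rV[R]_d) :
  enorm x ^+ 2 = \sum_(i < d) x ord0 i ^+ 2.
Proof. by rewrite sqr_sqrtr// sumr_ge0// => i _; exact: sqr_ge0. Qed.

Lemma box_volume_ge0 (R : realType) (d : nat) (a b : 'rV[R]_d) :
  0 <= box_volume a b.
Proof. by apply: prodr_ge0 => i _; rewrite le_max lexx. Qed.

Lemma lebesgue_outer_ge0 (R : realType) (d : nat) (A : set 'rV[R]_d) :
  (0 <= lebesgue_outer A)%E.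
Proof.
apply: le_ereal_inf_tmp => _ [a [b [_ ->]]].
by apply: nneseries_ge0 => k _ _; rewrite lee_fin box_volume_ge0.
Qed.

Lemma le_lebesgue_outer (R : realType) (d : nat) :
  {homo @lebesgue_outer R d : A B / A `<=` B >-> (A <= B)%E}.
Proof.
move=> A B AB; apply: ereal_inf_le_tmp => _ [a [b [Bab ->]]].
by exists a, b; split => //; exact: subset_trans Bab.
Qed.

Lemma lebesgue_outer_le_box (R : realType) (d : nat) (a b : 'rV[R]_d.+1) A :
  A `<=` box a b -> (lebesgue_outer A <= (box_volume a b)%:E)%E.
Proof.
move=> Aab; apply: ereal_inf_lbound.
exists (fun k => if k == 0%N then a else 0),
  (fun k => if k == 0%N then b else 0).
split; first by move=> x /Aab ?; exists 0%N.
rewrite (nneseries_split 0 1); last first.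
  by move=> k _; rewrite lee_fin box_volume_ge0.
rewrite big_nat1 eseries0 ?adde0// => -[//|k] _ _.
by rewrite /box_volume (bigD1 ord0)//= !mxE subrr maxxx mul0r.
Qed.

Lemma lebesgue_outer0 (R : realType) (d : nat) :
  lebesgue_outer (set0 : set 'rV[R]_d.+1) = 0%E.
Proof.
apply/eqP; rewrite eq_le lebesgue_outer_ge0 andbT.
apply: (le_trans (lebesgue_outer_le_box (a := 0) (b := 0) _)) => //.
by rewrite lee_fin /box_volume (bigD1 ord0)//= !mxE subrr maxxx mul0r.
Qed.

(** Covers of the A_n that are optimal up to e / 2^(n+1) are merged into one
    sequence of boxes along a bijection between nat and nat * nat. *)
Lemma lebesgue_outer_sigma_subadditive (R : realType) (d : nat) :
  sigma_subadditive (@lebesgue_outer R d).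
Proof.
move=> A; have [[i Aioo]|] := pselect (exists i, lebesgue_outer (A i) = +oo%E).
  rewrite (eseries_pinfty _ _ Aioo) ?leey// => n _.
  by rewrite -ltNye (lt_le_trans _ (lebesgue_outer_ge0 _)).
rewrite -forallNE => Afin.
apply/lee_addgt0Pr => e e_gt0.
apply: le_trans (epsilon_trick _ _ (ltW e_gt0)); last first.
  by move=> n; exact: lebesgue_outer_ge0.
have cover n : exists ab : nat -> 'rV[R]_d * 'rV[R]_d,
    A n `<=` \bigcup_k box (ab k).1 (ab k).2 /\
    (\sum_(0 <= k <oo) (box_volume (ab k).1 (ab k).2)%:E
      <= lebesgue_outer (A n) + (e / (2 ^ n.+1)%:R)%:E)%E.
  have e2 : 0 < e / (2 ^ n.+1)%:R by rewrite divr_gt0 ?ltr0n ?expn_gt0.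
  have Anfin : lebesgue_outer (A n) \is a fin_num.
    by rewrite ge0_fin_numE ?lebesgue_outer_ge0// ltey; apply/eqP/Afin.
  have [_ [a [b [Aab ->]]] lt_ab] := lb_ereal_inf_adherent e2 Anfin.
  by exists (fun k => (a k, b k)); split => //=; exact: (ltW lt_ab).
have [ab abP] := choice cover.
have vol_ge0 n k : (0 <= (box_volume (ab n k).1 (ab n k).2)%:E)%E.
  by rewrite lee_fin box_volume_ge0.
have /card_esym/ppcard_eqP[f] := card_nat2.
apply: (@le_trans _ _ (\sum_(0 <= n <oo)
    \sum_(0 <= k <oo) (box_volume (ab n k).1 (ab n k).2)%:E)%E); last first.
  apply: lee_nneseries => [n _ _|n _]; last exact: (abP n).2.
  by apply: nneseries_ge0 => k _ _; exact: vol_ge0.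
apply: ereal_inf_lbound.
exists (fun i => (ab (f i).1 (f i).2).1), (fun i => (ab (f i).1 (f i).2).2).
split.
  move=> x [n _ /(proj1 (abP n))[k _ xbox]].
  by exists (f^-1%FUN (n, k)) => //=; rewrite invK ?inE.
pose v (p : nat * nat) := (box_volume (ab p.1 p.2).1 (ab p.1 p.2).2)%:E.
rewrite !nneseries_esumT//; last first.
  by move=> n; apply: nneseries_ge0 => k _ _; exact: vol_ge0.
under eq_esum do rewrite nneseries_esumT//.
rewrite (esum_esum (I := setT) (J := fun=> setT) (a := fun n k => v (n, k)))//.
rewrite (reindex_esum setT _ f v)//.
- rewrite (_ : _ `*`` _ = setT); first exact: 'bij_f.
  by apply/seteqP; split => -[].
- by move=> n k _ _; exact: vol_ge0.
Qed.

Lemma interval_length_cut (R : realDomainType) (a b t : R) :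
  Num.max 0 (b - a) =
  Num.max 0 (Num.min b t - a) + Num.max 0 (b - Num.max a t).
Proof.
have [bt|tb] := leP b t; have [at_|ta] := leP a t.
- by rewrite [X in _ = _ + X](_ : _ = 0) ?addr0//; apply/max_idPl; lra.
- by rewrite !(@max_l _ _ 0) ?addr0//; lra.
- by rewrite !(@max_r _ _ 0)//; lra.
- by rewrite [X in _ = X + _](_ : _ = 0) ?add0r//; apply/max_idPl; lra.
Qed.

(** The hyperplane x_i = t cuts a box into two boxes; this exactness is what
    makes half-spaces measurable. *)
Lemma box_volume_cut (R : realType) (d : nat) (a b : 'rV[R]_d) i (t : R) :
  box_volume a b =
  box_volume a (\row_j (if j == i then Num.min (b ord0 j) t else b ord0 j)) +
  box_volume (\row_j (if j == i then Num.max (a ord0 j) t else a ord0 j)) b.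
Proof.
have volE (x y : 'rV[R]_d) : box_volume x y = Num.max 0 (y ord0 i - x ord0 i) *
    \prod_(j < d | j != i) Num.max 0 (y ord0 j - x ord0 j).
  by rewrite /box_volume (bigD1 i).
rewrite !volE !mxE eqxx.
under [in X in _ = X + _]eq_bigr => j /negPf ji do rewrite mxE ji.
under [in X in _ = _ + X]eq_bigr => j /negPf ji do rewrite mxE ji.
by rewrite -mulrDl -interval_length_cut.
Qed.

HB.instance Definition _ (R : realType) (d : nat) :=
  isOuterMeasure.Build R 'rV[R]_d.+1 (@lebesgue_outer R d.+1)
    (@lebesgue_outer0 R d) (@lebesgue_outer_ge0 R d.+1)
    (@le_lebesgue_outer R d.+1) (@lebesgue_outer_sigma_subadditive R d.+1).

Lemma halfspace_caratheodory (R : realType) (d : nat) (i : 'I_d.+1) (t : R) :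
  (@lebesgue_outer R d.+1).-caratheodory [set x | t < x ord0 i].
Proof.
apply: le_caratheodory_measurable => X.
apply: le_ereal_inf_tmp => _ [a [b [Xab ->]]].
pose lo j := \row_l (if l == i then Num.min (b j ord0 l) t else b j ord0 l).
pose hi j := \row_l (if l == i then Num.max (a j ord0 l) t else a j ord0 l).
under eq_eseriesr do rewrite (box_volume_cut _ _ i t) EFinD addrC.
rewrite nneseriesD; [|by move=> *; rewrite lee_fin box_volume_ge0..].
apply: leeD; apply: ereal_inf_lbound.
- exists hi, b; split => // x [Xx tx].
  have [k _ xab] := Xab x Xx; exists k => // j.
  have /andP[ax xb] := xab j; rewrite mxE xb andbT.
  by case: eqP => [ji|//]; rewrite gt_max ax /= ji.
- exists a, lo; split => // x [Xx /negP]; rewrite -leNgt => xt.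
  have [k _ xab] := Xab x Xx; exists k => // j.
  have /andP[ax xb] := xab j; rewrite mxE ax /=.
  by case: eqP => [ji|//]; rewrite le_min xb /= ji.
Qed.

(** Measurability of half-spaces makes the coordinates measurable functions for
    the Caratheodory sigma-algebra, hence also the sum of their squares. *)
Lemma sublevel_caratheodory (R : realType) (d : nat) (s : R) :
  (@lebesgue_outer R d.+1).-caratheodory [set x | enorm x ^+ 2 <= s].
Proof.
pose T := caratheodory_type (@lebesgue_outer R d.+1).
have coord i : measurable_fun [set: T] (fun x : T => (x : 'rV[R]_d.+1) ord0 i).
  apply: (measurability (@measurable_realfun.RGenOInfty.G R)).
    exact: measurable_realfun.RGenOInfty.measurableE.
  move=> _ [_ [t ->] <-]; rewrite setTI.
  have := halfspace_caratheodory i t.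
  by congr (caratheodory_measurable _ _); apply/seteqP; split => x;
    rewrite /= in_itv/= andbT.
have norm2 : measurable_fun [set: T]
    (fun x : T => \sum_(i < d.+1) (x : 'rV[R]_d.+1) ord0 i ^+ 2).
  by apply: measurable_sum => i; apply: measurable_funX.
have := norm2 measurableT `]-oo, s]%classic (measurable_itv _).
rewrite setTI; congr (caratheodory_measurable _ _).
by apply/seteqP; split => x; rewrite /= in_itv/= sqr_enorm.
Qed.

(** * Volume of balls *)

Definition dilate (R : realType) (d : nat) (t : R) (A : set 'rV[R]_d) :=
  [set t *: x | x in A].

Lemma lebesgue_outer_dilate_le (R : realType) (d : nat) (t : R)
    (A : set 'rV[R]_d) : 0 < t ->
  (lebesgue_outer (dilate t A) <= (t ^+ d)%:E * lebesgue_outer A)%E.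
Proof.
move=> t0; rewrite -lee_pdivrMl ?exprn_gt0//.
apply: le_ereal_inf_tmp => _ [a [b [Aab ->]]].
rewrite lee_pdivrMl ?exprn_gt0// -nneseriesZl; last first.
  by move=> k _; rewrite lee_fin box_volume_ge0.
apply: ereal_inf_lbound; exists (fun k => t *: a k), (fun k => t *: b k); split.
  move=> _ [x /Aab[k _ xab] <-]; exists k => // i.
  by rewrite !mxE ltr_pM2l// ler_pM2l// xab.
apply: eq_eseriesr => k _; rewrite -EFinM; congr EFin.
have -> : t ^+ d = \prod_(i < d) t by rewrite prodr_const card_ord.
rewrite /box_volume -big_split/=; apply: eq_bigr => i _.
by rewrite !mxE -mulrBr maxr_pMr ?mulr0// ltW.
Qed.

Lemma enormZ (R : realType) (d : nat) (t : R) (x : 'rV[R]_d) :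
  0 <= t -> enorm (t *: x) = t * enorm x.
Proof.
move=> t0; rewrite /enorm.
under eq_bigr do rewrite !mxE exprMn.
by rewrite -mulr_sumr sqrtrM ?sqr_ge0// sqrtr_sqr ger0_norm.
Qed.

Lemma dilate_eball (R : realType) (d : nat) (t r : R) : 0 < t ->
  dilate t (@eball R d r) = eball (t * r).
Proof.
move=> t0; apply/seteqP; split => [_ [x xr <-]|x xr].
  by rewrite /eball /= enormZ ?(ltW t0)// ler_pM2l.
exists (t^-1 *: x); last by rewrite scalerA divff ?scale1r// gt_eqF.
by rewrite /eball /= enormZ ?invr_ge0 ?(ltW t0)// ler_pdivrMl.
Qed.

(** The dilation inequality, used for r and for its inverse, is an equality on
    balls. *)
Lemma lebesgue_outer_eball (R : realType) (d : nat) (r : R) : 0 < r ->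
  lebesgue_outer (@eball R d r) =
  ((r ^+ d)%:E * lebesgue_outer (@eball R d 1))%E.
Proof.
move=> r0; apply/eqP; rewrite eq_le; apply/andP; split.
  have := @lebesgue_outer_dilate_le _ d r (eball 1) r0.
  by rewrite dilate_eball// mulr1.
have ri0 : 0 < r^-1 by rewrite invr_gt0.
have := @lebesgue_outer_dilate_le _ d r^-1 (eball r) ri0.
by rewrite dilate_eball// mulVf ?gt_eqF// exprVn lee_pdivlMl ?exprn_gt0.
Qed.

Lemma lebesgue_measure_ocitv (R : realType) (a b : R) :
  lebesgue_measure `]a, b]%classic = (Num.max 0 (b - a))%:E.
Proof.
rewrite lebesgue_measure_itv/= lte_fin -EFinB.
case: ltP => ab; congr EFin; apply/esym.
  by apply: max_r; rewrite subr_ge0 ltW.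
by apply: max_l; rewrite subr_le0.
Qed.

(** [box_volume] with coordinates indexed by all of nat, so that the dimension
    can vary in an induction without casts. *)
Definition prod_length (R : realType) (d : nat) (a b : nat -> R) : R :=
  \prod_(i < d) Num.max 0 (b i - a i).

Lemma prod_length_ge0 (R : realType) (d : nat) (a b : nat -> R) :
  0 <= prod_length d a b.
Proof. by apply: prodr_ge0 => i _; rewrite le_max lexx. Qed.

(** Induction on the dimension by slicing: for each value t of the last
    coordinate, the slices of those covering boxes whose last side contains t
    cover the slice of the big box, and integrating over t with the
    one-dimensional Lebesgue measure gives the inequality one dimension up. The
    predicate w keeps track of the boxes selected by the coordinates fixed so
    far; emptying the other boxes would not do, since in dimension 0 every box
    is a point. *)
Lemma prod_length_le_cover (R : realType) (d : nat) (a b : nat -> R)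
    (A B : nat -> nat -> R) (w : pred nat) :
  (forall x : nat -> R, (forall i, (i < d)%N -> a i < x i <= b i) ->
    exists2 k, w k & forall i, (i < d)%N -> A k i < x i <= B k i) ->
  ((prod_length d a b)%:E <=
   \sum_(0 <= k <oo) ((w k)%:R * prod_length d (A k) (B k))%:E)%E.
Proof.
elim: d w => [|d IH] w cover.
  have [k wk _] := cover (fun=> 0) (fun i => ltac:(by [])).
  apply: le_trans (nneseries_lim_ge k.+1 _); last first.
    by move=> j _ _; rewrite lee_fin mulr_ge0// prod_length_ge0.
  rewrite big_nat_recr//= wk /prod_length !big_ord0 mul1r.
  apply: leeDr; apply: sume_ge0 => j _.
  by rewrite lee_fin mulr_ge0// big_ord0.
pose I k : set R := `]A k d, B k d]%classic.
pose D : set R := `]a d, b d]%classic.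
pose c k := (w k)%:R * prod_length d (A k) (B k).
have c_ge0 k : 0 <= c k by rewrite mulr_ge0// prod_length_ge0.
have mD : measurable D by exact: measurable_itv.
have mI k : measurable (I k) by exact: measurable_itv.
have slice t : D t -> ((prod_length d a b)%:E <=
    \sum_(0 <= k <oo) (c k)%:E * (\1_(I k) t)%:E)%E.
  rewrite /D /= in_itv /= => tD.
  apply: le_trans (IH (fun k => w k && (A k d < t <= B k d)) _) _.
    move=> x xab.
    have [|k wk kx] := cover (fun i => if i == d then t else x i).
      move=> i; rewrite ltnS leq_eqVlt; case: eqP => [->//|_ /=]; exact: xab.
    exists k; first by have := kx d (leqnn _); rewrite eqxx wk => ->.
    move=> i id; have := kx i (ltnW id).
    by rewrite ltn_eqF.
  apply: lee_nneseries => [k _ _|k _].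
    by rewrite lee_fin mulr_ge0// prod_length_ge0.
  rewrite -EFinM lee_fin /c indicE /I mem_setE in_itv /=.
  by case: (w k); case: (_ < _ <= _); rewrite ?mul0r ?mul1r ?mulr0 ?mulr1.
have m1 k : measurable_fun D (fun t => (\1_(I k) t : R)%:E).
  by apply/measurable_EFinP; exact: measurable_indic.
have mc k : measurable_fun D (fun t => (c k)%:E * (\1_(I k) t)%:E)%E.
  exact: emeasurable_funM.
have c1_ge0 k t : (0 <= (c k)%:E * (\1_(I k) t)%:E)%E.
  by rewrite mule_ge0// lee_fin.
apply: (@le_trans _ _
  (\int[lebesgue_measure]_(t in D) (prod_length d a b)%:E)%E).
  rewrite integral_cst// /prod_length big_ord_recr EFinM.
  by rewrite -lebesgue_measure_ocitv.
apply: (@le_trans _ _ (\int[lebesgue_measure]_(t in D)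
    \sum_(0 <= k <oo) ((c k)%:E * (\1_(I k) t)%:E))%E).
  apply: ge0_le_integral => //.
  - by move=> t _; rewrite lee_fin prod_length_ge0.
  - apply: (ge0_emeasurable_sum (P := xpredT)) => [k t _ _|k _].
    + exact: c1_ge0.
    + exact: mc.
rewrite integral_nneseries//.
apply: lee_nneseries => [k _ _|k _]; first by apply: integral_ge0.
rewrite ge0_integralZl//; [|exact: m1|by rewrite lee_fin].
rewrite integral_indic; [|exact: mD|exact: mI].
rewrite /prod_length big_ord_recr /= mulrA -/(c k).
rewrite [leRHS]EFinM lee_wpmul2l ?lee_fin// -lebesgue_measure_ocitv.
apply: le_measure; rewrite ?inE; [exact: measurableI (mI k) mD|exact: mI|].
exact: subIsetl.
Qed.

Lemma box_volume_le_lebesgue_outer (R : realType) (d : nat)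
    (a b : 'rV[R]_d.+1) :
  ((box_volume a b)%:E <= lebesgue_outer (box a b))%E.
Proof.
apply: le_ereal_inf_tmp => _ [A [B [cover ->]]].
pose coord (x : 'rV[R]_d.+1) (i : nat) := x ord0 (inord i).
have volE x y : box_volume x y = prod_length d.+1 (coord x) (coord y).
  by apply: eq_bigr => i _; rewrite /coord inord_val.
rewrite volE.
apply: le_trans (prod_length_le_cover (A := fun k => coord (A k))
  (B := fun k => coord (B k)) (w := xpredT) _) _.
  move=> x xab; have [i|k _ kx] := cover (\row_i x i).
    by rewrite mxE; have := xab i (ltn_ord i); rewrite /coord inord_val.
  by exists k => // i id; have := kx (inord i); rewrite mxE inordK.
by apply: lee_nneseries => k *; rewrite mul1r -volE// lee_fin box_volume_ge0.
Qed.

Lemma lebesgue_outer_eball_fin (R : realType) (d : nat) (r : R) :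
  (lebesgue_outer (@eball R d.+1 r) < +oo)%E.
Proof.
apply: (@le_lt_trans _ _
  (box_volume (const_mx (- r - 1)) (const_mx (r + 1)) : R)%:E);
  last exact: ltry.
apply: lebesgue_outer_le_box => x xr i; rewrite !mxE.
have xi : x ord0 i ^+ 2 <= enorm x ^+ 2.
  by rewrite sqr_enorm (bigD1 i)//= lerDl sumr_ge0// => j _; exact: sqr_ge0.
have e0 : 0 <= enorm x by exact: sqrtr_ge0.
have : enorm x <= r by [].
by move=> er; apply/andP; split; nra.
Qed.

(** The unit ball contains a cube of side 1/(d+1) with a corner at the
    origin. *)
Lemma lebesgue_outer_eball_gt0 (R : realType) (d : nat) :
  (0 < lebesgue_outer (@eball R d.+1 1))%E.
Proof.
pose s : R := d.+1%:R^-1.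
have s0 : 0 < s by rewrite invr_gt0.
apply: (@lt_le_trans _ _ (box_volume 0 (const_mx s : 'rV[R]_d.+1))%:E).
  rewrite lte_fin; apply: prodr_gt0 => i _.
  by rewrite !mxE subr0 lt_max s0 orbT.
apply: le_trans (box_volume_le_lebesgue_outer _ _) _.
apply: le_lebesgue_outer => x xs.
rewrite /eball /= -(@ler_pXn2r _ 2) ?nnegrE ?sqrtr_ge0//.
rewrite expr1n sqr_enorm.
apply: (@le_trans _ _ (\sum_(i < d.+1) s)).
  apply: ler_sum => i _; have := xs i; rewrite !mxE => /andP[x0 xs'].
  have s1 : s <= 1 by rewrite invf_le1// ler1n.
  by nra.
by rewrite sumr_const card_ord -mulr_natl mulfV// gt_eqF.
Qed.

(** * Chords of convex functions *)

(** The convex function s |-> s^((e+2)/2) lies above its tangent at y^2, seen at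
    z^2. The induction goes by steps of two, on the exponent. *)
Lemma expr_sqr_tangent (R : realFieldType) (e : nat) (y z : R) :
  0 <= y -> 0 <= z ->
  e.+2%:R * y ^+ e * (z ^+ 2 - y ^+ 2) <= 2 * (z ^+ e.+2 - y ^+ e.+2).
Proof.
move=> y0 z0; suff [] : e.+2%:R * y ^+ e * (z ^+ 2 - y ^+ 2)
    <= 2 * (z ^+ e.+2 - y ^+ e.+2) /\
  e.+3%:R * y ^+ e.+1 * (z ^+ 2 - y ^+ 2)
    <= 2 * (z ^+ e.+3 - y ^+ e.+3) by [].
elim: e => [|e [IH1 IH2]]; split => //.
- by rewrite expr0 mulr1.
- have -> : 2 * (z ^+ 3 - y ^+ 3) =
      3 * y ^+ 1 * (z ^+ 2 - y ^+ 2) + (z - y) ^+ 2 * (2 * z + y) by ring.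
  by rewrite lerDl mulr_ge0 ?sqr_ge0//; lra.
have -> : 2 * (z ^+ e.+4 - y ^+ e.+4) =
    z ^+ 2 * (2 * (z ^+ e.+2 - y ^+ e.+2)) +
    2 * y ^+ e.+2 * (z ^+ 2 - y ^+ 2) by rewrite !exprS; ring.
apply: le_trans (lerD (ler_wpM2l (sqr_ge0 z) IH1) (lexx _)).
rewrite -subr_ge0 (_ : _ - _ = e.+2%:R * y ^+ e * (z ^+ 2 - y ^+ 2) ^+ 2).
  by apply: mulr_ge0 (sqr_ge0 _); apply: mulr_ge0 => //; exact: exprn_ge0.
by rewrite (natrD _ 2 e.+2) !exprS; ring.
Qed.

(** Convexity on the nonnegative reals as an inequality between the slopes of
    adjacent chords, with denominators cleared. *)
Definition chord_convex (R : realType) (g : R -> R) := forall s t u : R,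
  0 <= s -> s <= t -> t <= u -> (g t - g s) * (u - t) <= (g u - g t) * (t - s).

Lemma chord_convex_sqrtX (R : realType) (e : nat) :
  chord_convex (fun t : R => Num.sqrt t ^+ e.+2).
Proof.
move=> s t u s0 st tu.
have t0 := le_trans s0 st; have u0 := le_trans t0 tu.
have := expr_sqr_tangent e (sqrtr_ge0 t) (sqrtr_ge0 u).
have := expr_sqr_tangent e (sqrtr_ge0 t) (sqrtr_ge0 s).
rewrite !(sqr_sqrtr s0, sqr_sqrtr t0, sqr_sqrtr u0).
set k := _ * _ ^+ e => H1 H2.
have tu0 : 0 <= u - t by lra.
have st0 : 0 <= t - s by lra.
have := ler_wpM2r tu0 H1; have := ler_wpM2r st0 H2.
lra.
Qed.

Lemma chord_convexN_sqrt (R : realType) :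
  chord_convex (fun t : R => - Num.sqrt t).
Proof.
move=> s t u s0 st tu.
have t0 := le_trans s0 st; have u0 := le_trans t0 tu.
rewrite -{2}(sqr_sqrtr s0) -{2 4}(sqr_sqrtr t0) -{1}(sqr_sqrtr u0).
have xy : Num.sqrt s <= Num.sqrt t by rewrite ler_wsqrtr.
have yz : Num.sqrt t <= Num.sqrt u by rewrite ler_wsqrtr.
move: (sqrtr_ge0 s) xy yz.
set x := Num.sqrt s; set y := Num.sqrt t; set z := Num.sqrt u.
move=> x0 xy yz.
rewrite -subr_ge0 (_ : _ - _ = (y - x) * (z - y) * (z - x)); last by ring.
by rewrite !mulr_ge0//; lra.
Qed.

(** By convexity, the increment of g over [M, M + th] is at most th times its
    increment over [M, M + 1] and at least th times its increment over
    [M - 1, M]; both bounds telescope. *)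
Lemma sum_chords (R : realType) (g : R -> R) (G : nat -> R) (th : R) :
  chord_convex g -> 0 <= th <= 1 ->
  (forall N, G N.+2 = G N.+1 + (g (N.+1%:R + th) - g N.+1%:R)) ->
  forall N, th * (g N%:R - g 0) <= G N.+1 - G 1%N <= th * (g N.+1%:R - g 1).
Proof.
move=> cg /andP[th0 th1] GS; elim=> [|N /andP[IH1 IH2]].
  by rewrite !subrr !mulr0 lexx.
rewrite GS.
have N0 : 0 <= N%:R :> R by [].
have := cg N%:R (N.+1%:R) (N.+1%:R + th) N0.
have := cg N.+1%:R (N.+1%:R + th) (N.+2%:R).
rewrite -!natr1.
set a := g N%:R in IH1 *; set b := g (N%:R + 1); rewrite -natr1 -/b in IH2.
move=> c1 c2; have {c1} := c1 ltac:(lra) ltac:(lra) ltac:(lra).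
have {c2} := c2 ltac:(lra) ltac:(lra).
by move=> c2 c1; apply/andP; split; lra.
Qed.


(** * Density of a union of spherical shells *)

Definition shells (R : realType) (d : nat) (th : R) : set 'rV[R]_d :=
  [set x | exists m : nat, m%:R < enorm x ^+ 2 <= m%:R + th].

Lemma shells_caratheodory (R : realType) (d : nat) (th : R) :
  lebesgue_measurable (@shells R d.+1 th).
Proof.
have -> : @shells R d.+1 th = \bigcup_(m : nat)
   ([set x | enorm x ^+ 2 <= m%:R + th] `\` [set x | enorm x ^+ 2 <= m%:R]).
  apply/seteqP; split => x /=.
    move=> [m /andP[mx xm]]; exists m => //; split => //=.
    by apply/negP; rewrite -ltNge.
  move=> [m _ [/= xm /negP]]; rewrite -ltNge => mx.
  by exists m; rewrite mx.
apply: caratheodory_measurable_bigcup => m.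
by apply: caratheodory_measurable_setD; exact: sublevel_caratheodory.
Qed.

Definition ball_volume (R : realType) (d : nat) : R :=
  fine (lebesgue_outer (@eball R d 1)).

Lemma ball_volume_gt0 (R : realType) (d : nat) : 0 < ball_volume R d.+1.
Proof.
by apply: fine_gt0; rewrite lebesgue_outer_eball_gt0 lebesgue_outer_eball_fin.
Qed.

Lemma lebesgue_outer_eballE (R : realType) (d : nat) (r : R) : 0 < r ->
  lebesgue_outer (@eball R d.+1 r) = (r ^+ d.+1 * ball_volume R d.+1)%:E.
Proof.
move=> r0; rewrite lebesgue_outer_eball// EFinM /ball_volume fineK//.
by rewrite ge0_fin_numE ?lebesgue_outer_ge0// lebesgue_outer_eball_fin.
Qed.

Lemma sublevel_eball (R : realType) (d : nat) (s : R) : 0 <= s ->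
  [set x : 'rV[R]_d | enorm x ^+ 2 <= s] = eball (Num.sqrt s).
Proof.
move=> s0; have E x : (enorm x <= Num.sqrt s) = (@enorm R d x ^+ 2 <= s).
  by rewrite -{2}(sqr_sqrtr s0) ler_pXn2r ?nnegrE ?sqrtr_ge0.
by apply/seteqP; split => x; rewrite /eball /= E.
Qed.

Lemma subset_eball_fin_num (R : realType) (d : nat) (r : R)
    (A : set 'rV[R]_d.+1) :
  A `<=` eball r -> lebesgue_outer A \is a fin_num.
Proof.
move=> Ar; rewrite ge0_fin_numE ?lebesgue_outer_ge0//.
by apply: le_lt_trans (le_lebesgue_outer Ar) _; exact: lebesgue_outer_eball_fin.
Qed.

Definition shells_volume (R : realType) (d : nat) (th s : R) : R :=
  fine (lebesgue_outer (shells th `&` [set x : 'rV[R]_d | enorm x ^+ 2 <= s]))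
  / ball_volume R d.

(** Up to radius sqrt (N + 2), the only shell beyond radius sqrt (N + 1) is the
    difference of two balls. The strict inequality th < 1 keeps the next shells
    apart. *)
Lemma shells_volumeS (R : realType) (d N : nat) (th : R) : 0 <= th < 1 ->
  shells_volume d.+1 th N.+2%:R = shells_volume d.+1 th N.+1%:R +
    (Num.sqrt (N.+1%:R + th) ^+ d.+1 - Num.sqrt N.+1%:R ^+ d.+1).
Proof.
move=> /andP[th0 th1].
pose L s := [set x : 'rV[R]_d.+1 | enorm x ^+ 2 <= s].
have V0 := ball_volume_gt0 R d.
have Nth0 : 0 < N.+1%:R + th :> R by rewrite ltr_wpDr.
have volL s : 0 < s ->
    lebesgue_outer (L s) = (Num.sqrt s ^+ d.+1 * ball_volume R d.+1)%:E.
  move=> s0; rewrite /L sublevel_eball ?(ltW s0)//.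
  by rewrite lebesgue_outer_eballE// sqrtr_gt0.
have LN := @sublevel_caratheodory R d N.+1%:R.
have LNfin (A : set 'rV[R]_d.+1) s : 0 <= s -> A `<=` L s ->
    lebesgue_outer A \is a fin_num.
  by move=> s0; rewrite /L sublevel_eball// => /subset_eball_fin_num.
have := LN (shells th `&` L N.+2%:R).
have -> : shells th `&` L N.+2%:R `&` [set x | enorm x ^+ 2 <= N.+1%:R] =
          shells th `&` L N.+1%:R.
  rewrite -setIA; congr (_ `&` _); apply/setIidPr => x /= /le_trans; apply.
  by rewrite ler_nat.
have -> : shells th `&` L N.+2%:R `&` ~` [set x | enorm x ^+ 2 <= N.+1%:R] =
          L (N.+1%:R + th) `&` ~` [set x | enorm x ^+ 2 <= N.+1%:R].
  apply/seteqP; split => x [] => [[[m /andP[mx xm]] xN /negP]|xN /negP Nx].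
    rewrite -ltNge => Nx; split; last by apply/negP; rewrite -ltNge.
    suff <- : m = N.+1 by [].
    rewrite /L /= in xN.
    apply/eqP; rewrite eqn_leq; apply/andP.
    split; rewrite -ltnS -(ltr_nat R); first exact: lt_le_trans mx xN.
    by rewrite -(natr1 m); lra.
  split; last exact/negP; rewrite -ltNge in Nx; split.
    by exists N.+1; rewrite Nx.
  by apply: le_trans xN _; rewrite -(natr1 N.+1) lerD2l ltW.
have := LN (L (N.+1%:R + th)).
have -> : L (N.+1%:R + th) `&` [set x | enorm x ^+ 2 <= N.+1%:R] = L N.+1%:R.
  by apply/setIidPr => x /= /le_trans; apply; rewrite lerDl.
rewrite !volL//.
set D := L _ `&` ~` _.
have Dfin : lebesgue_outer D \is a fin_num.
  exact: (LNfin _ (N.+1%:R + th) (ltW Nth0) (@subIsetl _ _ _)).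
have S1fin : lebesgue_outer (shells th `&` L N.+1%:R) \is a fin_num.
  exact: (LNfin _ N.+1%:R (ler0n _ _) (@subIsetr _ _ _)).
rewrite /shells_volume -/(L _) -/(L _) => E1 ->.
move: E1; rewrite -(fineK Dfin) -(fineK S1fin) -!EFinD => -[E1] /=.
have -> : fine (lebesgue_outer D) =
    (Num.sqrt (N.+1%:R + th) ^+ d.+1 - Num.sqrt N.+1%:R ^+ d.+1) *
    ball_volume R d.+1.
  by rewrite mulrBl E1 addrC addKr.
by field; rewrite gt_eqF.
Qed.

Lemma le_shells_volume (R : realType) (d : nat) (th s s' : R) :
  0 <= s' -> s <= s' -> shells_volume d.+1 th s <= shells_volume d.+1 th s'.
Proof.
move=> s'0 ss'; rewrite /shells_volume ler_pM2r ?invr_gt0 ?ball_volume_gt0//.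
have sub u : u <= s' -> shells th `&` [set x : 'rV[R]_d.+1 | enorm x ^+ 2 <= u]
    `<=` eball (Num.sqrt s').
  by rewrite -sublevel_eball// => us' x [_ /= xu]; exact: le_trans us'.
apply: fine_le; [exact: subset_eball_fin_num (sub _ _)..|].
by apply: le_lebesgue_outer => x [xE /= xs]; split => //=; exact: le_trans ss'.
Qed.

Lemma shells_volume1 (R : realType) (d : nat) (th : R) :
  0 <= shells_volume d.+1 th 1 <= 1.
Proof.
have V0 := ball_volume_gt0 R d.
rewrite /shells_volume divr_ge0 ?(ltW V0) ?fine_ge0 ?lebesgue_outer_ge0//=.
rewrite ler_pdivrMr// mul1r sublevel_eball// sqrtr1.
apply: fine_le; [exact: subset_eball_fin_num (@subIsetr _ _ _)|
                 exact: subset_eball_fin_num (@subset_refl _ _)|].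
by apply: le_lebesgue_outer; exact: subIsetr.
Qed.

(** The chord estimate applies to (sqrt s)^d when d >= 2, and to - sqrt s when
    d = 1; the common weaker form below covers both. *)
Lemma shells_volume_bounds (R : realType) (d N : nat) (th : R) : 0 <= th < 1 ->
  th * Num.sqrt N%:R ^+ d.+1 - 1 <= shells_volume d.+1 th N.+1%:R
    <= th * Num.sqrt N.+1%:R ^+ d.+1 + 1.
Proof.
move=> th01; have /andP[th0 th1] := th01.
have thle : 0 <= th <= 1 by rewrite th0 ltW.
have /andP[G0 G1] := @shells_volume1 R d th.
pose G (M : nat) := shells_volume d.+1 th (M%:R : R).
have GS (M : nat) : G M.+2 = G M.+1 + _ := shells_volumeS d M th01.
have mono : Num.sqrt N%:R ^+ d.+1 <= Num.sqrt N.+1%:R ^+ d.+1 :> R.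
  by rewrite ler_pXn2r ?nnegrE ?sqrtr_ge0// ler_wsqrtr// ler_nat.
rewrite -/(G N.+1) -/(G 1%N) in G0 G1 *.
case: d G GS mono G0 G1 => [|d] G GS mono G0 G1.
  pose GN M := - G M.
  have GNS M : GN M.+2 = GN M.+1 +
      (- Num.sqrt (M.+1%:R + th) - - Num.sqrt M.+1%:R).
    by rewrite /GN GS !expr1; ring.
  have := sum_chords (@chord_convexN_sqrt R) thle GNS N.
  rewrite sqrtr0 sqrtr1 /GN; rewrite !expr1 in mono *.
  by nra.
have := sum_chords (@chord_convex_sqrtX R d) thle GS N.
rewrite sqrtr0 sqrtr1 expr0n expr1n /=.
by nra.
Qed.

(** The gap between the integers around r^2 is absorbed by moving the radius by
    1, as (r - 1)^2 <= r^2 - 2 and r^2 + 1 <= (r + 1)^2. *)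
Lemma shells_volume_sandwich (R : realType) (d : nat) (th r : R) :
  0 <= th < 1 -> 2 <= r ->
  th * (r - 1) ^+ d.+1 - 1 <= shells_volume d.+1 th (r ^+ 2)
    <= th * (r + 1) ^+ d.+1 + 1.
Proof.
move=> th01 r2; have /andP[th0 th1] := th01.
have r0 : 0 <= r by lra.
have /andP[Nr rN] := truncn_itv (sqr_ge0 r).
set N := Num.truncn _ in Nr rN.
case: N Nr rN => [|N] Nr rN; first by nra.
have /andP[lo _] := @shells_volume_bounds R d N th th01.
have /andP[_ hi] := @shells_volume_bounds R d N.+1 th th01.
rewrite -!natr1 in Nr rN hi lo.
apply/andP; split.
  apply: le_trans (_ : th * Num.sqrt N%:R ^+ d.+1 - 1 <= _).
    rewrite lerD2r ler_wpM2l// ler_pXn2r ?nnegrE ?sqrtr_ge0//; last by lra.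
    by rewrite -(@ler_pXn2r _ 2) ?nnegrE ?sqrtr_ge0 ?sqr_sqrtr//; nra.
  by apply: le_trans lo _; apply: le_shells_volume => //; exact: sqr_ge0.
apply: le_trans (le_shells_volume _ _ _ (ltW rN)) _; first by rewrite !addr_ge0.
apply: le_trans hi _.
rewrite lerD2r ler_wpM2l// ler_pXn2r ?nnegrE ?sqrtr_ge0//; last by lra.
by rewrite -(@ler_pXn2r _ 2) ?nnegrE ?sqrtr_ge0 ?sqr_sqrtr ?addr_ge0//; nra.
Qed.

Lemma has_density_shells (R : realType) (d : nat) (th : R) : 0 <= th < 1 ->
  has_density (@shells R d.+1 th) th.
Proof.
move=> th01; have /andP[th0 th1] := th01.
have V0 := ball_volume_gt0 R d.
pose D := d.+1.
have inv0 : (fun r : R => r^-1) @ +oo --> (0 : R).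
  apply/(gtr0_cvgV0 (f := id)); last exact: cvg_id.
  exact: nbhs_pinfty_gt.
have powcvg (a : R) : (fun r : R => th * (1 + a * r^-1) ^+ D) @ +oo --> th.
  suff : (fun r : R => th * (1 + a * r^-1) ^+ D) @ +oo -->
      th * (1 + a * 0) ^+ D.
    by rewrite mulr0 addr0 expr1n mulr1.
  apply: cvgMl_tmp.
  apply: (@continuous_cvg _ _ _ _ _
    (fun r : R => 1 + a * r^-1) (fun x => x ^+ D)).
    exact: exprn_continuous.
  by apply: cvgD; [exact: cvg_cst|exact: cvgMl_tmp].
apply: (@squeeze_cvgr _ _ _ _ (fun r : R => th * (1 + (-1) * r^-1) ^+ D - r^-1)
  (fun r : R => th * (1 + 1 * r^-1) ^+ D + r^-1)); last 2 first.
- by have H := cvgB (powcvg (-1)) inv0; rewrite subr0 in H; exact: H.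
- by have H := cvgD (powcvg 1) inv0; rewrite addr0 in H; exact: H.
near=> r.
have r2 : 2 <= r by near: r; exact: nbhs_pinfty_ge.
have r0 : 0 < r by lra.
have rD0 : 0 < r ^+ D by rewrite exprn_gt0.
have -> : fine (lebesgue_outer (shells th `&` @eball R D r)) /
          fine (lebesgue_outer (@eball R D r)) =
          shells_volume D th (r ^+ 2) / r ^+ D.
  rewrite lebesgue_outer_eballE//= /shells_volume sublevel_eball ?sqr_ge0//.
  rewrite sqrtr_sqr ger0_norm ?(ltW r0)//.
  by field; rewrite !gt_eqF.
have /andP[lo hi] := @shells_volume_sandwich R d th r th01 r2.
have rDr : (r ^+ D)^-1 <= r^-1.
  rewrite lef_pV2 ?posrE// -[leLHS]expr1 ler_weXn2l//; lra.
have E a : (r + a) ^+ D / r ^+ D = (1 + a * r^-1) ^+ D.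
  rewrite -expr_div_n mulrDl divff ?gt_eqF//.
rewrite -!E; apply/andP; split.
  apply: le_trans (_ : (th * (r - 1) ^+ D - 1) / r ^+ D <= _).
    by rewrite mulrBl mul1r -mulrA lerD2l lerN2.
  by rewrite ler_pM2r ?invr_gt0.
apply: le_trans (_ : (th * (r + 1) ^+ D + 1) / r ^+ D <= _).
  by rewrite ler_pM2r ?invr_gt0.
by rewrite mulrDl mul1r -mulrA lerD2l.
Unshelve. all: by end_near. Qed.

Lemma has_density_set0 (R : realType) (d : nat) :
  has_density (set0 : set 'rV[R]_d.+1) 0.
Proof.
rewrite /has_density (_ : (fun r => _) = cst 0); first exact: cvg_cst.
by apply/funext => r; rewrite set0I lebesgue_outer0 mul0r.
Qed.

(** * Progressions and quadratic sequences modulo 1 *)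

Definition dot (R : realType) (d : nat) (x y : 'rV[R]_d) : R :=
  \sum_(i < d) x ord0 i * y ord0 i.


Lemma sqr_enormBZ (R : realType) (d : nat) (k : R) (x y : 'rV[R]_d) :
  enorm (x - k *: y) ^+ 2 =
  enorm x ^+ 2 - 2 * k * dot x y + k ^+ 2 * enorm y ^+ 2.
Proof.
rewrite !sqr_enorm /dot !mulr_sumr -sumrB -big_split /=.
by apply: eq_bigr => i _; rewrite !mxE; ring.
Qed.

Lemma enorm_eq0 (R : realType) (d : nat) (x : 'rV[R]_d) :
  enorm x ^+ 2 = 0 -> x = 0.
Proof.
rewrite sqr_enorm => /eqP; rewrite psumr_eq0; last first.
  by move=> i _; exact: sqr_ge0.
move/allP => x0; apply/rowP => i; rewrite mxE; apply/eqP.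
by have := x0 i; rewrite mem_index_enum /= sqrf_eq0; apply.
Qed.

(** Equality in the triangle inequality: the distances give
    <x_j - x_0, v> = j r^2 for v = x_1 - x_0, whence |x_j - x_0 - j v|^2 = 0. *)
Lemma progression_quadratic (R : realType) (d n : nat) (r : R)
    (x : 'I_n -> 'rV[R]_d) : (1 < n)%N ->
  (forall j k : 'I_n, enorm (x j - x k) = `|j%:R - k%:R| * r) ->
  exists A B : R, forall j : 'I_n,
    enorm (x j) ^+ 2 = A + B * j%:R + r ^+ 2 * j%:R ^+ 2.
Proof.
move=> n_gt1 dist; pose o := Ordinal (ltnW n_gt1); pose e := Ordinal n_gt1.
have dist2 j k : enorm (x j - x k) ^+ 2 = (j%:R - k%:R) ^+ 2 * r ^+ 2.
  by rewrite dist exprMn real_normK ?num_real.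
pose v := x e - x o.
have vn : enorm v ^+ 2 = r ^+ 2 by rewrite dist2 /=; ring.
have collinear j : x j - x o = j%:R *: v.
  apply/eqP; rewrite -subr_eq0; apply/eqP; apply: enorm_eq0.
  have : enorm (x j - x e) ^+ 2 = enorm (x j - x o) ^+ 2
      - 2 * dot (x j - x o) v + enorm v ^+ 2.
    have -> : x j - x e = x j - x o - v.
      by rewrite /v opprB addrA subrK.
    by have := sqr_enormBZ 1 (x j - x o) v; rewrite scale1r => ->; ring.
  rewrite sqr_enormBZ vn !dist2 /= => E; nra.
exists (enorm (x o) ^+ 2), (2 * dot (x o) v) => j.
have -> : x j = x o - (- j%:R) *: v.
  by rewrite scaleNr opprK -collinear addrC subrK.
by rewrite sqr_enormBZ vn; ring.
Qed.

(** A sequence that moves forward modulo 1 by more than one full turn, in steps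
    no longer than the gap of length 1 - th, must visit the gap. The integer M
    changes the sequence by integers only, and lets the leading coefficient be
    arbitrarily large. *)
Lemma quadratic_meets_gap (R : realType) (q n M : nat) (A B th : R) :
  (0 < q)%N -> (q * q + 2 * q + 4 < 2 * n)%N ->
  th <= 1 - 2 * (q%:R + 1) / q%:R ^+ 2 ->
  ~ (forall j : nat, (j < n)%N -> exists m : int,
    m%:~R < A + B * j%:R + (M%:R + q%:R ^- 2) * j%:R ^+ 2 <= m%:~R + th).
Proof.
move=> q_gt0 qn thq H.
have q0 : 0 < q%:R :> R by rewrite ltr0n.
set c : R := q%:R ^- 2 in H *.
have c0 : 0 < c by rewrite invr_gt0 exprn_gt0.
have cq : c * q%:R ^+ 2 = 1 by rewrite mulVf// expf_neq0// gt_eqF.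
have {}thq : th <= 1 - 2 * c * (q%:R + 1).
  by rewrite (le_trans thq)// lerD2l lerN2 /c -mulrA [_^-1 * _]mulrC mulrA.
have th1 : th < 1.
  have : 0 < c * (q%:R + 1) by rewrite mulr_gt0// ltr_pwDl.
  lra.
(* [beta + 2 M j + 2 c j] is the increment from index j to j + 1. The least
   integer beyond beta is p + 1, and j0 is the first index j at which
   [beta + 2 c j] has passed it. *)
pose beta := B + M%:R + c; pose p := Num.floor beta.
have /andP[pb bp] := floor_itv beta; rewrite -/p in pb bp.
have {}bp : beta < p%:~R + 1 by rewrite -intrD1.
pose y : R := (p%:~R + 1 - beta) * q%:R ^+ 2 / 2.
have yc : p%:~R + 1 - beta = 2 * c * y.
  rewrite /y.
  rewrite (_ : 2 * c * _ = (p%:~R + 1 - beta) * (c * q%:R ^+ 2)); last by field.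
  by rewrite cq mulr1.
have y0 : 0 <= y.
  by rewrite /y !mulr_ge0// ?invr_ge0 ?exprn_ge0 ?(ltW q0)//; lra.
have yq : y <= q%:R ^+ 2 / 2.
  by rewrite /y ler_wpM2r// ger_pMl ?exprn_gt0//; lra.
pose j0 := (Num.truncn y).+1.
have /andP[] := truncn_itv y0; rewrite -/j0 => j0y yj0.
have {}j0y : j0%:R <= y + 1 by rewrite /j0 -natr1 lerD2r.
have j0n : (j0 + q.+1 < n)%N.
  have : (2 * j0)%:R <= (q * q + 2)%:R :> R.
    by rewrite !natrD !natrM; rewrite expr2 in yq; lra.
  by rewrite ler_nat; nia.
pose f (j : nat) : R := A + B * j%:R + (M%:R + c) * j%:R ^+ 2.
(* The increment at j0, modulo 1; the later ones are theta + 2 c i. *)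
pose theta := 2 * c * (j0%:R - y).
have theta0 : 0 <= theta by rewrite /theta; nra.
have theta_le : theta <= 2 * c by rewrite /theta; nra.
(* A representative modulo 1 of the sequence after j0, free of integer jumps. *)
pose g (i : nat) : R := f j0 + theta * i%:R + c * i%:R * (i%:R - 1).
have fg i : exists z : int, f (j0 + i)%N = g i + z%:~R.
  exists ((p + 1) * i%:Z - M%:Z * i%:Z + 2 * M%:Z * j0%:Z * i%:Z
          + M%:Z * i%:Z * i%:Z).
  have Bq : B = theta + p%:~R + 1 - 2 * c * j0%:R - M%:R - c.
    by rewrite /theta mulrBr -yc /beta; ring.
  by rewrite /g /f Bq !(intrD, intrM, intrN) -!pmulrn natrD; ring.
have [m0 /andP[m0f fm0]] := H j0 (leq_ltn_trans (leq_addr _ _) j0n).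
rewrite -/(f j0) in m0f fm0.
have g0 : g 0%N = f j0 by rewrite /g; ring.
(* Steps of g are too short to cross the gap, so g never leaves the unit
   interval it starts in, although it must advance by 1. *)
have stay i : (i <= q.+1)%N -> m0%:~R < g i <= m0%:~R + th.
  elim: i => [|i IH] iq; first by rewrite g0 m0f.
  have /andP[gi_gt gi_le] := IH (ltnW iq).
  have iqR : i%:R <= q%:R :> R by rewrite ler_nat.
  have gS : g i.+1 = g i + theta + 2 * c * i%:R.
    by rewrite /g -natr1; ring.
  have i0 : 0 <= i%:R :> R by [].
  have inc : g i.+1 <= m0%:~R + 1 by rewrite gS; nra.
  have lo : m0%:~R < g i.+1 by rewrite gS; nra.
  have [z fz] := fg i.+1.
  have [m] := H (j0 + i.+1)%N (leq_ltn_trans (leq_add (leqnn _) iq) j0n).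
  rewrite -/(f _) fz => /andP[m_lt m_le].
  suff -> : m0 = m - z by rewrite intrB; apply/andP; split; lra.
  apply/eqP; rewrite eq_le -!ltzD1 -!(ltr_int R) !(intrD, intrB).
  by apply/andP; split; lra.
have /andP[_ ] := stay q.+1 (leqnn _).
have : g q.+1 >= f j0 + 1.
  have E : c * (q%:R + 1) * q%:R = 1 + c * q%:R.
    by lra.
  rewrite /g -natr1 addrK E.
  have := mulr_ge0 theta0 (addr_ge0 (ltW q0) ler01).
  by have := mulr_gt0 c0 q0; lra.
lra.
Qed.

Lemma shells_progression_free (R : realType) (q n d M : nat) (r th : R) :
  (0 < q)%N -> (q * q + 2 * q + 4 < 2 * n)%N ->
  th <= 1 - 2 * (q%:R + 1) / q%:R ^+ 2 ->
  r ^+ 2 = M%:R + q%:R ^- 2 ->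
  ~ contains_progression n r (@shells R d th).
Proof.
move=> q0 qn thq r2 [x [xE dist]].
have n1 : (1 < n)%N by nia.
have [A [B quad]] := progression_quadratic n1 dist.
apply: (@quadratic_meets_gap R q n M A B th q0 qn thq) => j jn.
have [m] := xE (Ordinal jn); rewrite quad r2 /= => xm.
by exists m%:Z.
Qed.

Lemma ln_ge_half (R : realType) (n : nat) : (2 <= n)%N ->
  1 / 2 <= ln (n%:R : R).
Proof.
move=> n2.
have : ln (1 + - (1 / 2) : R) <= - (1 / 2) by apply: le_ln1Dx; lra.
have -> : 1 + - (1 / 2) = 2^-1 :> R by field.
rewrite lnV ?posrE// lerN2 => /le_trans; apply.
by rewrite ler_ln ?posrE ?ltr0n ?ler_nat// (leq_trans _ n2).
Qed.

(** Crude: log n >= log 2 >= 1/2 and n^(1/5) <= n^(1/2). *)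
Lemma density_bound (R : realType) (n : nat) : (2 <= n)%N ->
  5 / Num.sqrt n%:R <= 10 * ln (n%:R : R) / (n%:R `^ (1 / 5)).
Proof.
move=> n2.
have n0 : 0 < n%:R :> R by rewrite ltr0n (leq_trans _ n2).
have p0 : 0 < (n%:R : R) `^ (1 / 5) by rewrite powR_gt0.
have le_sqrt : (n%:R : R) `^ (1 / 5) <= Num.sqrt n%:R.
  rewrite -powR12_sqrt ?(ltW n0)//; apply: ler_powR; last by lra.
  by rewrite ler1n (leq_trans _ n2).
have := ln_ge_half R n2 => l.
apply: ler_pM; rewrite ?invr_ge0 ?sqrtr_ge0//; first by lra.
by rewrite lef_pV2 ?posrE ?sqrtr_gt0.
Qed.

Theorem theorem1p5 (R : realType) (n d : nat) (hn : (2 <= n)%N) (hd : (1 <= d)%N) :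
  exists E : set 'rV[R]_d,
    [/\ lebesgue_measurable E,
        exists2 delta : R, has_density E delta &
          1 - 10 * ln (n%:R : R) / (n%:R `^ (1 / 5)) <= delta
      & forall M : R, exists r : R,
          [/\ M < r, 0 < r & ~ contains_progression n r E]].
Proof.
case: d hd => // d _.
have bound := density_bound R hn.
have n0 : 0 < n%:R :> R by rewrite ltr0n (leq_trans _ hn).
have rn0 : 0 < Num.sqrt n%:R :> R by rewrite sqrtr_gt0.
have rn2 : Num.sqrt n%:R ^+ 2 = n%:R :> R by rewrite sqr_sqrtr// ltW.
(* 25 is where 5 / sqrt n, the lower bound on the allowed loss, drops to 1; it
   also gives 5 <= q, the room needed by the two phases of the argument. *)
have [n25|n25] := ltnP n 25.
  exists set0; split.
  - exact: caratheodory_measurable_set0.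
  - exists 0; first exact: has_density_set0.
    rewrite subr_le0; apply: le_trans bound; rewrite ler_pdivlMr// mul1r.
    rewrite -(@ler_pXn2r _ 2) ?nnegrE ?(ltW rn0)// rn2 -natrX ler_nat.
    exact: ltnW.
  - move=> M; exists (`|M| + 1); split.
    + by rewrite (le_lt_trans (ler_norm M))// ltrDl.
    + by rewrite ltr_wpDl.
    + by move=> [x [/(_ (Ordinal (ltnW hn)))]].
pose q := Num.truncn (Num.sqrt n%:R : R).
have /andP[qn nq] := truncn_itv (ltW rn0); rewrite -/q in qn nq.
have q5 : (5 <= q)%N.
  have n25R : 25 <= n%:R :> R by rewrite ler_nat.
  rewrite -ltnS -(ltr_nat R); apply: le_lt_trans nq.
  by rewrite -(@ler_pXn2r _ 2) ?nnegrE ?(ltW rn0)// rn2; lra.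
have q5R : 5 <= q%:R :> R by rewrite ler_nat.
have qqn : (q * q <= n)%N.
  by rewrite -(ler_nat R) natrM -rn2 expr2 ler_pM.
pose th : R := 1 - 2 * (q%:R + 1) / q%:R ^+ 2.
have gap : 2 * (q%:R + 1) / q%:R ^+ 2 <= 5 / (q%:R + 1) :> R.
  rewrite ler_pdivrMr ?exprn_gt0//; last by lra.
  rewrite mulrAC ler_pdivlMr; last by lra.
  by nra.
have gap0 : 0 < 2 * (q%:R + 1) / q%:R ^+ 2 :> R.
  by rewrite divr_gt0 ?exprn_gt0//; lra.
have gap1 : 5 / (q%:R + 1) <= 1 :> R by rewrite ler_pdivrMr; lra.
exists (shells th); split.
- exact: shells_caratheodory.
- exists th; first by apply: has_density_shells; rewrite /th; lra.
  rewrite /th lerD2l lerN2; apply: le_trans gap _; apply: le_trans bound.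
  rewrite -natr1 in nq.
  by rewrite ler_pM2l// lef_pV2 ?posrE//; lra.
move=> M; pose K := (Num.truncn (M ^+ 2)).+1.
have /andP[_ MK] := truncn_itv (sqr_ge0 M); rewrite -/K in MK.
have c0 : 0 < q%:R ^- 2 :> R by rewrite invr_gt0 exprn_gt0//; lra.
have Kc0 : 0 < K%:R + q%:R ^- 2 :> R by rewrite addr_gt0.
exists (Num.sqrt (K%:R + q%:R ^- 2)); split.
- have [M0|M0] := ltP M 0; first by rewrite (lt_le_trans M0)// sqrtr_ge0.
  by rewrite -(@ltr_pXn2r _ 2) ?nnegrE ?sqrtr_ge0// sqr_sqrtr ?(ltW Kc0)//; lra.
- by rewrite sqrtr_gt0.
apply: (@shells_progression_free R q n d.+1 K _ th) => //.
- by rewrite (leq_trans _ q5).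
- by nia.
- by rewrite sqr_sqrtr// ltW.
Qed.
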